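(* Let $\mathcal{I}$ be a small category, let $\mathfrak{B}=(\mathcal{C},F,U)$ be an adjunction bundle over $\mathcal{I}$, and let $G\colon\mathcal{D}\to\mathbf{Tw}(\mathcal{I},\mathfrak{B})$ be a functor. Suppose that for every object $i\in\mathcal{I}$ the limit of $Ev_i\circ G\colon\mathcal{D}\to\mathcal{C}_i$ exists. Then $\lim G$ exists in $\mathbf{Tw}(\mathcal{I},\mathfrak{B})$, and for every $i$ the canonical map $Ev_i(\lim G)\to\lim(Ev_i\circ G)$ is an isomorphism. Similarly, if for every object $i\in\mathcal{I}$ the colimit of $Ev_i\circ G$ exists, then $\operatorname{colim}G$ exists in $\mathbf{Tw}(\mathcal{I},\mathfrak{B})$, and for every $i$ the canonical map $\operatorname{colim}(Ev_i\circ G)\to Ev_i(\operatorname{colim}G)$ is an isomorphism.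
   Context: An adjunction bundle $\mathfrak{B}=(\mathcal{C},F,U)$ over a small category $\mathcal{I}$ consists of a category $\mathcal{C}_i$ for each object $i$ and, for each morphism $\sigma\colon i\to j$, an adjoint pair $F_\sigma\colon\mathcal{C}_i\to\mathcal{C}_j$ (left adjoint), $U_\sigma\colon\mathcal{C}_j\to\mathcal{C}_i$ (right adjoint), such that $U_{\mathrm{id}_i}=\mathrm{id}=F_{\mathrm{id}_i}$ and $U_{\tau\circ\sigma}=U_\sigma\circ U_\tau$ for composable $\sigma,\tau$. A twisted diagram $Y$ with coefficients in $\mathfrak{B}$ consists of objects $Y_i\in\mathcal{C}_i$ and maps $y_\sigma^\flat\colon Y_i\to U_\sigma(Y_j)$ for $\sigma\colon i\to j$ with $y^\flat_{\mathrm{id}_i}=\mathrm{id}$ and $y^\flat_{\tau\circ\sigma}=U_\sigma(y^\flat_\tau)\circ y^\flat_\sigma$. A map $f\colon Y\to Z$ is a family of maps $f_i\colon Y_i\to Z_i$ in $\mathcal{C}_i$ with $U_\sigma(f_j)\circ y^\flat_\sigma=z^\flat_\sigma\circ f_i$ for all $\sigma\colon i\to j$. The resulting category is $\mathbf{Tw}(\mathcal{I},\mathfrak{B})$. The evaluation functor $Ev_i\colon\mathbf{Tw}(\mathcal{I},\mathfrak{B})\to\mathcal{C}_i$ sends $Y$ to $Y_i$. *)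

(* Defs.v *)
From Stdlib Require Import ProofIrrelevance FunctionalExtensionality.

Set Implicit Arguments.
Unset Strict Implicit.
Unset Printing Implicit Defensive.

Declare Scope cat_scope.
Delimit Scope cat_scope with cat.
Reserved Notation "g ∘ f" (at level 40, left associativity).

(* Objects and morphisms live in a fixed universe; "small" is understood
   relative to it, and morphisms are compared with Leibniz equality. *)
Record Category : Type := {
  Obj :> Type;
  Hom : Obj -> Obj -> Type;
  idm : forall X, Hom X X;
  comp : forall X Y Z, Hom Y Z -> Hom X Y -> Hom X Z;
  comp_idl : forall X Y (f : Hom X Y), comp (idm Y) f = f;
  comp_idr : forall X Y (f : Hom X Y), comp f (idm X) = f;
  comp_assoc : forall W X Y Z (h : Hom Y Z) (g : Hom X Y) (f : Hom W X),
    comp h (comp g f) = comp (comp h g) f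
}.

Arguments Hom {c} X Y.
Arguments idm {c} X.
Arguments comp {c X Y Z} g f.

Notation "g ∘ f" := (comp g f) : cat_scope.
Open Scope cat_scope.

Definition is_iso (C : Category) (X Y : C) (f : Hom X Y) : Prop :=
  exists g : Hom Y X, g ∘ f = idm X /\ f ∘ g = idm Y.

Record Functor (C D : Category) : Type := {
  fobj :> C -> D;
  fmap : forall X Y, Hom X Y -> Hom (fobj X) (fobj Y);
  fmap_id : forall X, fmap (idm X) = idm (fobj X);
  fmap_comp : forall X Y Z (g : Hom Y Z) (f : Hom X Y),
    fmap (g ∘ f) = fmap g ∘ fmap f
}.

Arguments fmap {C D} _ {X Y} _.

Definition functor_id (C : Category) : Functor C C :=
  {| fobj := fun X => X;
     fmap := fun X Y h => h;
     fmap_id := fun X => eq_refl;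
     fmap_comp := fun X Y Z g f => eq_refl |}.

Definition functor_comp (C D E : Category) (G : Functor D E) (F : Functor C D) :
  Functor C E.
Proof.
  refine {| fobj := fun X => G (F X);
            fmap := fun X Y h => fmap G (fmap F h) |}.
  - intros X; rewrite fmap_id; apply fmap_id.
  - intros X Y Z g f; rewrite fmap_comp; apply fmap_comp.
Defined.

(* The component at [X] of the identity transformation between two equal
   functors: the objects [F X] and [G X] need not be convertible, so equalities
   of functors enter formulas between morphisms through this map. *)
Definition eq_hom (C D : Category) (F G : Functor C D) (e : F = G) (X : C) :
  Hom (F X) (G X) :=
  match e in _ = G' return Hom (F X) (G' X) with
  | eq_refl => idm (F X)
  end.

Record Adjunction (C D : Category) (F : Functor C D) (U : Functor D C) : Type := {
  flat : forall (X : C) (Y : D), Hom (F X) Y -> Hom X (U Y);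
  sharp : forall (X : C) (Y : D), Hom X (U Y) -> Hom (F X) Y;
  flatK : forall X Y (f : Hom (F X) Y), sharp (flat f) = f;
  sharpK : forall X Y (g : Hom X (U Y)), flat (sharp g) = g;
  flat_nat : forall X X' Y Y' (h : Hom X' X) (f : Hom (F X) Y) (k : Hom Y Y'),
    flat (k ∘ f ∘ fmap F h) = fmap U k ∘ flat f ∘ h
}.

Record Cone (D C : Category) (G : Functor D C) (X : C) : Type := {
  cone_leg :> forall d : D, Hom X (G d);
  cone_nat : forall (d d' : D) (u : Hom d d'),
    fmap G u ∘ cone_leg d = cone_leg d'
}.

Record Cocone (D C : Category) (G : Functor D C) (X : C) : Type := {
  cocone_leg :> forall d : D, Hom (G d) X;
  cocone_nat : forall (d d' : D) (u : Hom d d'),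
    cocone_leg d' ∘ fmap G u = cocone_leg d
}.

(* A limit is a chosen universal cone; "the limit of [G] exists" is
   [inhabited (Limit G)]. *)
Record Limit (D C : Category) (G : Functor D C) : Type := {
  lim :> C;
  lim_cone : Cone G lim;
  lim_lift : forall X : C, Cone G X -> Hom X lim;
  lim_fac : forall (X : C) (c : Cone G X) (d : D),
    lim_cone d ∘ lim_lift c = c d;
  lim_uniq : forall (X : C) (c : Cone G X) (h : Hom X lim),
    (forall d : D, lim_cone d ∘ h = c d) -> h = lim_lift c
}.

Record Colimit (D C : Category) (G : Functor D C) : Type := {
  colim :> C;
  colim_cocone : Cocone G colim;
  colim_desc : forall X : C, Cocone G X -> Hom colim X;
  colim_fac : forall (X : C) (c : Cocone G X) (d : D),
    colim_desc c ∘ colim_cocone d = c d;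
  colim_uniq : forall (X : C) (c : Cocone G X) (h : Hom colim X),
    (forall d : D, h ∘ colim_cocone d = c d) -> h = colim_desc c
}.

Definition map_cone (D C E : Category) (H : Functor C E) (G : Functor D C)
  (X : C) (c : Cone G X) : Cone (functor_comp H G) (H X).
Proof.
  refine {| cone_leg := fun d : D =>
              (fmap H (c d) : Hom (H X) (functor_comp H G d)) |}.
  intros d d' u; simpl; rewrite <- fmap_comp, cone_nat; reflexivity.
Defined.

Definition map_cocone (D C E : Category) (H : Functor C E) (G : Functor D C)
  (X : C) (c : Cocone G X) : Cocone (functor_comp H G) (H X).
Proof.
  refine {| cocone_leg := fun d : D =>
              (fmap H (c d) : Hom (functor_comp H G d) (H X)) |}.
  intros d d' u; simpl; rewrite <- fmap_comp, cocone_nat; reflexivity.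
Defined.

Definition lim_compare (D C E : Category) (H : Functor C E) (G : Functor D C)
  (L : Limit G) (L' : Limit (functor_comp H G)) : Hom (H L) L' :=
  lim_lift L' (map_cone H (lim_cone L)).

Definition colim_compare (D C E : Category) (H : Functor C E) (G : Functor D C)
  (L : Colimit G) (L' : Colimit (functor_comp H G)) : Hom L' (H L) :=
  colim_desc L' (map_cocone H (colim_cocone L)).

(* The identities between functors are strict: they hold on the nose, on objects
   and on morphisms.  As for the left adjoints, only [F_id] is required; their
   compatibility with composition is then automatic up to isomorphism. *)
Record AdjunctionBundle (I : Category) : Type := {
  fib :> I -> Category;
  bF : forall i j : I, Hom i j -> Functor (fib i) (fib j);
  bU : forall i j : I, Hom i j -> Functor (fib j) (fib i);
  b_adj : forall (i j : I) (s : Hom i j), Adjunction (bF s) (bU s);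
  bF_id : forall i : I, bF (idm i) = functor_id (fib i);
  bU_id : forall i : I, bU (idm i) = functor_id (fib i);
  bU_comp : forall (i j k : I) (s : Hom i j) (t : Hom j k),
    bU (t ∘ s) = functor_comp (bU s) (bU t)
}.

Arguments bF {I} _ {i j} _.
Arguments bU {I} _ {i j} _.
Arguments bU_id {I} _ i.
Arguments bU_comp {I} _ {i j k} _ _.

Section TwistedDiagrams.

Variables (I : Category) (B : AdjunctionBundle I).

Record TwDiag : Type := {
  tw_obj :> forall i : I, B i;
  tw_flat : forall (i j : I) (s : Hom i j), Hom (tw_obj i) (bU B s (tw_obj j));
  tw_flat_id : forall i : I,
    eq_hom (bU_id B i) (tw_obj i) ∘ tw_flat (idm i) = idm (tw_obj i);
  tw_flat_comp : forall (i j k : I) (s : Hom i j) (t : Hom j k),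
    eq_hom (bU_comp B s t) (tw_obj k) ∘ tw_flat (t ∘ s)
    = fmap (bU B s) (tw_flat t) ∘ tw_flat s
}.

Record TwHom (Y Z : TwDiag) : Type := {
  tw_map :> forall i : I, Hom (Y i) (Z i);
  tw_map_nat : forall (i j : I) (s : Hom i j),
    fmap (bU B s) (tw_map j) ∘ tw_flat Y s = tw_flat Z s ∘ tw_map i
}.

Lemma TwHom_ext (Y Z : TwDiag) (f g : TwHom Y Z) :
  (forall i, f i = g i) -> f = g.
Proof.
  destruct f as [f nf], g as [g ng]; simpl; intros e.
  assert (e' : f = g) by (apply functional_extensionality_dep; exact e).
  subst g; f_equal; apply proof_irrelevance.
Qed.

Definition tw_idm (Y : TwDiag) : TwHom Y Y.
Proof.
  refine {| tw_map := fun i => idm (Y i) |}.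
  intros i j s; rewrite fmap_id, comp_idl, comp_idr; reflexivity.
Defined.

Definition tw_comp (X Y Z : TwDiag) (g : TwHom Y Z) (f : TwHom X Y) : TwHom X Z.
Proof.
  refine {| tw_map := fun i => g i ∘ f i |}.
  intros i j s.
  rewrite fmap_comp, <- comp_assoc, tw_map_nat, comp_assoc, tw_map_nat.
  symmetry; apply comp_assoc.
Defined.

Definition Tw : Category.
Proof.
  refine {| Obj := TwDiag; Hom := TwHom; idm := tw_idm; comp := tw_comp |}.
  - intros X Y f; apply TwHom_ext; intros i; apply comp_idl.
  - intros X Y f; apply TwHom_ext; intros i; apply comp_idr.
  - intros W X Y Z h g f; apply TwHom_ext; intros i; apply comp_assoc.
Defined.

Definition Ev (i : I) : Functor Tw (B i) :=
  {| fobj := fun Y : Tw => (Y : TwDiag) i;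
     fmap := fun (Y Z : Tw) (f : @Hom Tw Y Z) => (f : TwHom Y Z) i;
     fmap_id := fun Y => eq_refl;
     fmap_comp := fun X Y Z g f => eq_refl |}.

End TwistedDiagrams.

(* Main.v *)
Require Import Defs.
From Stdlib Require Import IndefiniteDescription.

Set Implicit Arguments.
Unset Strict Implicit.
Unset Printing Implicit Defensive.

(** Limits and colimits of twisted diagrams are computed fibrewise.

    Choose a limit [L i] of [Ev_i ∘ G] in every fibre, with projections
    [p_i d : L i -> (G d)_i].  Being a right adjoint, [U_s] preserves limits, so
    for [s : i -> j] the maps [(G d)_s^flat ∘ p_i d] induce a unique map
    [y_s : L i -> U_s (L j)] with [U_s (p_j d) ∘ y_s = (G d)_s^flat ∘ p_i d]
    ([tw_lim_flat], [tw_lim_flat_fac]).  This equation says precisely that the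
    [p_i d] assemble into maps of twisted diagrams.  The two axioms of a twisted
    diagram hold for [y] because they hold for each [G d] and because the legs
    [p_i d], resp. [U_s (U_t (p_k d))], of a limit cone detect equality of
    morphisms; the identities of functors in these axioms are moved past the
    legs by naturality ([eq_hom_nat]).  In the same way the map into [L] induced
    fibrewise by a cone is a map of twisted diagrams, so [L] is a limit of [G]
    ([tw_limit]).

    For colimits [C i] with injections [q_i d : (G d)_i -> C i], the structure
    maps [C i -> U_s (C j)] go out of a colimit, so they are induced directly by
    the cocone [U_s (q_j d) ∘ (G d)_s^flat] ([tw_colim_flat]), and the axioms
    are checked after composition with the [q_i d] ([tw_colimit]).

    For the limit just built and the chosen [L i], the comparison map is an
    identity.  Limits being unique up to isomorphism, whether a comparison map
    is invertible does not depend on the limits taken on either side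
    ([lim_compare_iso_indep]), so it is invertible for all of them. *)

(** * Uniqueness of limits and colimits *)

Lemma lim_hom_ext (D C : Category) (G : Functor D C) (L : Limit G) (X : C)
  (f g : Hom X L) :
  (forall d, lim_cone L d ∘ f = lim_cone L d ∘ g) -> f = g.
Proof.
  intros e.
  assert (n : forall (d d' : D) (u : Hom d d'),
             fmap G u ∘ (lim_cone L d ∘ g) = lim_cone L d' ∘ g)
    by (intros d d' u; rewrite comp_assoc, cone_nat; reflexivity).
  transitivity (lim_lift L (Build_Cone n)).
  - apply lim_uniq; exact e.
  - symmetry; apply lim_uniq; reflexivity.
Qed.

Lemma colim_hom_ext (D C : Category) (G : Functor D C) (L : Colimit G) (X : C)
  (f g : Hom L X) :
  (forall d, f ∘ colim_cocone L d = g ∘ colim_cocone L d) -> f = g.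
Proof.
  intros e.
  assert (n : forall (d d' : D) (u : Hom d d'),
             (g ∘ colim_cocone L d') ∘ fmap G u = g ∘ colim_cocone L d)
    by (intros d d' u; rewrite <- comp_assoc, cocone_nat; reflexivity).
  transitivity (colim_desc L (Build_Cocone n)).
  - apply colim_uniq; exact e.
  - symmetry; apply colim_uniq; reflexivity.
Qed.

Lemma is_iso_comp (C : Category) (X Y Z : C) (g : Hom Y Z) (f : Hom X Y) :
  is_iso g -> is_iso f -> is_iso (g ∘ f).
Proof.
  intros [g' [g'g gg']] [f' [f'f ff']]; exists (f' ∘ g'); split.
  - rewrite comp_assoc, <- (comp_assoc f' g' g), g'g, comp_idr; exact f'f.
  - rewrite comp_assoc, <- (comp_assoc g f f'), ff', comp_idr; exact gg'.
Qed.

Lemma is_iso_fmap (C D : Category) (H : Functor C D) (X Y : C) (f : Hom X Y) :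
  is_iso f -> is_iso (fmap H f).
Proof.
  intros [g [gf fg]]; exists (fmap H g).
  rewrite <- !fmap_comp, gf, fg, !fmap_id; split; reflexivity.
Qed.

Lemma lim_unique_iso (D C : Category) (G : Functor D C) (L L' : Limit G) :
  is_iso (lim_lift L' (lim_cone L)).
Proof.
  exists (lim_lift L (lim_cone L')).
  split; apply lim_hom_ext; intros d;
    rewrite comp_assoc, !lim_fac, comp_idr; reflexivity.
Qed.

Lemma colim_unique_iso (D C : Category) (G : Functor D C) (L L' : Colimit G) :
  is_iso (colim_desc L' (colim_cocone L)).
Proof.
  exists (colim_desc L (colim_cocone L')).
  split; apply colim_hom_ext; intros d;
    rewrite <- comp_assoc, !colim_fac, comp_idl; reflexivity.
Qed.

(** The comparison map for [L] and [L'] is the one for [L0] and [L0'], composed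
    on both sides with the isomorphisms between the respective limits. *)
Lemma lim_compare_iso_indep (D C E : Category) (H : Functor C E)
  (G : Functor D C) (L0 L : Limit G) (L0' L' : Limit (functor_comp H G)) :
  is_iso (lim_compare L0 L0') -> is_iso (lim_compare L L').
Proof.
  intros iso0.
  replace (lim_compare L L')
    with (lim_lift L' (lim_cone L0')
            ∘ (lim_compare L0 L0' ∘ fmap H (lim_lift L0 (lim_cone L)))).
  - apply is_iso_comp; [apply lim_unique_iso|].
    apply is_iso_comp; [exact iso0|].
    apply is_iso_fmap, lim_unique_iso.
  - apply lim_hom_ext; intros d; unfold lim_compare.
    rewrite !comp_assoc, !lim_fac; simpl.
    rewrite <- fmap_comp, lim_fac; reflexivity.
Qed.

Lemma colim_compare_iso_indep (D C E : Category) (H : Functor C E)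
  (G : Functor D C) (L0 L : Colimit G) (L0' L' : Colimit (functor_comp H G)) :
  is_iso (colim_compare L0 L0') -> is_iso (colim_compare L L').
Proof.
  intros iso0.
  replace (colim_compare L L')
    with (fmap H (colim_desc L0 (colim_cocone L))
            ∘ (colim_compare L0 L0' ∘ colim_desc L' (colim_cocone L0'))).
  - apply is_iso_comp; [apply is_iso_fmap, colim_unique_iso|].
    apply is_iso_comp; [exact iso0|].
    apply colim_unique_iso.
  - apply colim_hom_ext; intros d; unfold colim_compare.
    rewrite <- !comp_assoc, !colim_fac; simpl.
    rewrite <- fmap_comp, colim_fac; reflexivity.
Qed.

(** * Right adjoints preserve limits *)

Lemma sharp_postcomp (C D : Category) (F : Functor C D) (U : Functor D C)
  (A : Adjunction F U) (X : C) (Y Y' : D) (k : Hom Y Y') (g : Hom X (U Y)) :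
  sharp A (fmap U k ∘ g) = k ∘ sharp A g.
Proof.
  rewrite <- (flatK A (k ∘ sharp A g)); f_equal.
  (* [flat_nat] also precomposes with [fmap F h]; it is used with [h] an
     identity. *)
  rewrite <- (comp_idr (k ∘ sharp A g)), <- fmap_id, flat_nat, sharpK, comp_idr.
  reflexivity.
Qed.

Lemma flat_postcomp (C D : Category) (F : Functor C D) (U : Functor D C)
  (A : Adjunction F U) (X : C) (Y Y' : D) (k : Hom Y Y') (f : Hom (F X) Y) :
  flat A (k ∘ f) = fmap U k ∘ flat A f.
Proof.
  rewrite <- (sharpK A (fmap U k ∘ flat A f)), sharp_postcomp, flatK.
  reflexivity.
Qed.

Lemma sharp_cone_nat (D C E : Category) (F : Functor C E) (U : Functor E C)
  (A : Adjunction F U) (G : Functor D E) (X : C)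
  (c : Cone (functor_comp U G) X) (d d' : D) (u : Hom d d') :
  fmap G u ∘ sharp A (c d) = sharp A (c d').
Proof.
  rewrite <- sharp_postcomp, <- (cone_nat c u); reflexivity.
Qed.

Definition sharp_cone (D C E : Category) (F : Functor C E) (U : Functor E C)
  (A : Adjunction F U) (G : Functor D E) (X : C)
  (c : Cone (functor_comp U G) X) : Cone G (F X) :=
  Build_Cone (sharp_cone_nat A c).

(** The universal property of [U L] is that of [L], transposed along the
    adjunction.  The definition is transparent, so that the apex and the legs
    are convertible to the images under [U] of those of [L]. *)
Definition right_adjoint_limit (D C E : Category) (F : Functor C E)
  (U : Functor E C) (A : Adjunction F U) (G : Functor D E) (L : Limit G) :
  Limit (functor_comp U G).
Proof.
  refine {| lim := U L;
            lim_cone := map_cone U (lim_cone L);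
            lim_lift := fun X c => flat A (lim_lift L (sharp_cone A c)) |}.
  - intros X c d; simpl.
    rewrite <- flat_postcomp, lim_fac; apply sharpK.
  - intros X c h e.
    rewrite <- (sharpK A h); f_equal.
    apply lim_uniq; intros d; simpl.
    rewrite <- sharp_postcomp, <- e; reflexivity.
Defined.

(** * Limits of twisted diagrams *)

(** Lets the equalities [bU_id] and [bU_comp] be moved past the legs of a limit
    or colimit, where they meet the axioms of the diagrams [G d]. *)
Lemma eq_hom_nat (C D : Category) (F G : Functor C D) (e : F = G) (X Y : C)
  (h : Hom X Y) :
  fmap G h ∘ eq_hom e X = eq_hom e Y ∘ fmap F h.
Proof.
  destruct e; simpl; rewrite comp_idl, comp_idr; reflexivity.
Qed.

Lemma tw_lim_flat_nat (I : Category) (B : AdjunctionBundle I) (D : Category)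
  (G : Functor D (Tw B)) (L : forall i, Limit (functor_comp (Ev B i) G))
  (i j : I) (s : Hom i j) (d d' : D) (u : Hom d d') :
  fmap (functor_comp (bU B s) (functor_comp (Ev B j) G)) u
    ∘ (tw_flat (G d) s ∘ lim_cone (L i) d)
  = tw_flat (G d') s ∘ lim_cone (L i) d'.
Proof.
  rewrite <- (cone_nat (lim_cone (L i)) u), !comp_assoc.
  f_equal; exact (tw_map_nat (fmap G u) s).
Qed.

(** The place where the left adjoints enter: a map into [U_s (L j)] can be
    defined by its composites with the legs because [U_s] preserves [L j]. *)
Definition tw_lim_flat (I : Category) (B : AdjunctionBundle I) (D : Category)
  (G : Functor D (Tw B)) (L : forall i, Limit (functor_comp (Ev B i) G))
  (i j : I) (s : Hom i j) : Hom (L i) (bU B s (L j)) :=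
  lim_lift (right_adjoint_limit (b_adj B s) (L j))
    (Build_Cone (tw_lim_flat_nat L s)).

Lemma tw_lim_flat_fac (I : Category) (B : AdjunctionBundle I) (D : Category)
  (G : Functor D (Tw B)) (L : forall i, Limit (functor_comp (Ev B i) G))
  (i j : I) (s : Hom i j) (d : D) :
  fmap (bU B s) (lim_cone (L j) d : Hom (L j) ((G d : TwDiag B) j))
    ∘ tw_lim_flat L s
  = tw_flat (G d) s ∘ (lim_cone (L i) d : Hom (L i) ((G d : TwDiag B) i)).
Proof.
  exact (lim_fac (right_adjoint_limit (b_adj B s) (L j))
           (Build_Cone (tw_lim_flat_nat L s)) d).
Qed.

Definition tw_lim (I : Category) (B : AdjunctionBundle I) (D : Category)
  (G : Functor D (Tw B)) (L : forall i, Limit (functor_comp (Ev B i) G)) :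
  TwDiag B.
Proof.
  refine {| tw_obj := fun i => L i; tw_flat := fun i j s => tw_lim_flat L s |}.
  - intros i; apply lim_hom_ext; intros d.
    rewrite comp_assoc, comp_idr.
    etransitivity; [apply f_equal2; [|reflexivity];
                    exact (eq_hom_nat (bU_id B i) (lim_cone (L i) d))|].
    simpl; rewrite <- comp_assoc, tw_lim_flat_fac, comp_assoc.
    etransitivity; [apply f_equal2; [|reflexivity]; exact (tw_flat_id (G d) i)|].
    apply comp_idl.
  - intros i j k s t.
    (* The target [U_s (U_t (L k))] is a limit, by two applications of limit
       preservation. *)
    apply (@lim_hom_ext _ _ _
             (right_adjoint_limit (b_adj B s)
                (right_adjoint_limit (b_adj B t) (L k)))); intros d; simpl.
    rewrite !comp_assoc, <- fmap_comp, tw_lim_flat_fac, fmap_comp.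
    rewrite <- (comp_assoc _ _ (tw_lim_flat L s)), tw_lim_flat_fac, comp_assoc.
    rewrite <- tw_flat_comp, <- !comp_assoc, <- tw_lim_flat_fac, !comp_assoc.
    f_equal; exact (eq_hom_nat (bU_comp B s t) (lim_cone (L k) d)).
Defined.

Definition tw_lim_leg (I : Category) (B : AdjunctionBundle I) (D : Category)
  (G : Functor D (Tw B)) (L : forall i, Limit (functor_comp (Ev B i) G))
  (d : D) : TwHom (tw_lim L) (G d) :=
  {| tw_map := fun i => (lim_cone (L i) d : Hom (tw_lim L i) ((G d : TwDiag B) i));
     tw_map_nat := fun i j s => tw_lim_flat_fac L s d |}.

Definition tw_lim_lift (I : Category) (B : AdjunctionBundle I) (D : Category)
  (G : Functor D (Tw B)) (L : forall i, Limit (functor_comp (Ev B i) G))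
  (X : Tw B) (c : Cone G X) : TwHom X (tw_lim L).
Proof.
  refine {| tw_map := fun i => (lim_lift (L i) (map_cone (Ev B i) c)
                                 : Hom ((X : TwDiag B) i) (tw_lim L i)) |}.
  intros i j s.
  apply (@lim_hom_ext _ _ _ (right_adjoint_limit (b_adj B s) (L j))); intros d.
  pose proof (lim_fac (L i) (map_cone (Ev B i) c) d) as faci.
  pose proof (lim_fac (L j) (map_cone (Ev B j) c) d) as facj.
  simpl in faci, facj |- *.
  rewrite !comp_assoc, <- fmap_comp, tw_lim_flat_fac, <- comp_assoc, faci, facj.
  exact (tw_map_nat (c d) s).
Defined.

Definition tw_limit (I : Category) (B : AdjunctionBundle I) (D : Category)
  (G : Functor D (Tw B)) (L : forall i, Limit (functor_comp (Ev B i) G)) :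
  Limit G.
Proof.
  unshelve refine {| lim := tw_lim L : Tw B;
            lim_cone := {| cone_leg := tw_lim_leg L : forall d, @Hom (Tw B) _ _ |};
            lim_lift := tw_lim_lift L |}.
  - intros d d' u; apply TwHom_ext; intros i.
    exact (cone_nat (lim_cone (L i)) u).
  - intros X c d; apply TwHom_ext; intros i.
    exact (lim_fac (L i) (map_cone (Ev B i) c) d).
  - intros X c h e; apply TwHom_ext; intros i.
    apply lim_uniq; intros d.
    exact (f_equal (fun f : TwHom X (G d) => f i) (e d)).
Defined.

Lemma tw_limit_compare_iso (I : Category) (B : AdjunctionBundle I)
  (D : Category) (G : Functor D (Tw B))
  (L : forall i, Limit (functor_comp (Ev B i) G)) (i : I) :
  is_iso (lim_compare (tw_limit L) (L i)).
Proof.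
  assert (e : lim_compare (tw_limit L) (L i) = idm (L i : B i)).
  { symmetry; apply lim_uniq; intros d; apply comp_idr. }
  rewrite e; exists (idm (L i : B i)); split; apply comp_idl.
Qed.

(** * Colimits of twisted diagrams *)

Lemma tw_colim_flat_nat (I : Category) (B : AdjunctionBundle I) (D : Category)
  (G : Functor D (Tw B)) (L : forall i, Colimit (functor_comp (Ev B i) G))
  (i j : I) (s : Hom i j) (d d' : D) (u : Hom d d') :
  (fmap (bU B s) (colim_cocone (L j) d') ∘ tw_flat (G d') s)
    ∘ fmap (functor_comp (Ev B i) G) u
  = fmap (bU B s) (colim_cocone (L j) d) ∘ tw_flat (G d) s.
Proof.
  rewrite <- (cocone_nat (colim_cocone (L j)) u), fmap_comp, <- !comp_assoc.
  f_equal; symmetry; exact (tw_map_nat (fmap G u) s).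
Qed.

Definition tw_colim_flat (I : Category) (B : AdjunctionBundle I) (D : Category)
  (G : Functor D (Tw B)) (L : forall i, Colimit (functor_comp (Ev B i) G))
  (i j : I) (s : Hom i j) : Hom (L i) (bU B s (L j)) :=
  colim_desc (L i) (Build_Cocone (tw_colim_flat_nat L s)).

Lemma tw_colim_flat_fac (I : Category) (B : AdjunctionBundle I) (D : Category)
  (G : Functor D (Tw B)) (L : forall i, Colimit (functor_comp (Ev B i) G))
  (i j : I) (s : Hom i j) (d : D) :
  tw_colim_flat L s ∘ (colim_cocone (L i) d : Hom ((G d : TwDiag B) i) (L i))
  = fmap (bU B s) (colim_cocone (L j) d : Hom ((G d : TwDiag B) j) (L j))
      ∘ tw_flat (G d) s.
Proof.
  exact (colim_fac (L i) (Build_Cocone (tw_colim_flat_nat L s)) d).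
Qed.

Definition tw_colim (I : Category) (B : AdjunctionBundle I) (D : Category)
  (G : Functor D (Tw B)) (L : forall i, Colimit (functor_comp (Ev B i) G)) :
  TwDiag B.
Proof.
  refine {| tw_obj := fun i => L i; tw_flat := fun i j s => tw_colim_flat L s |}.
  - intros i; apply colim_hom_ext; intros d; simpl.
    rewrite <- comp_assoc, tw_colim_flat_fac, comp_assoc, comp_idl.
    etransitivity; [apply f_equal2; [|reflexivity]; symmetry;
                    exact (eq_hom_nat (bU_id B i) (colim_cocone (L i) d))|].
    simpl; rewrite <- comp_assoc.
    etransitivity; [apply f_equal2; [reflexivity|]; exact (tw_flat_id (G d) i)|].
    apply comp_idr.
  - intros i j k s t; apply colim_hom_ext; intros d; simpl.
    rewrite <- !comp_assoc, !tw_colim_flat_fac.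
    rewrite (comp_assoc (fmap (bU B s) (tw_colim_flat L t))), <- fmap_comp.
    rewrite tw_colim_flat_fac, fmap_comp, <- comp_assoc, <- tw_flat_comp.
    rewrite !comp_assoc; f_equal; symmetry.
    exact (eq_hom_nat (bU_comp B s t) (colim_cocone (L k) d)).
Defined.

Definition tw_colim_leg (I : Category) (B : AdjunctionBundle I) (D : Category)
  (G : Functor D (Tw B)) (L : forall i, Colimit (functor_comp (Ev B i) G))
  (d : D) : TwHom (G d) (tw_colim L) :=
  {| tw_map := fun i =>
       (colim_cocone (L i) d : Hom ((G d : TwDiag B) i) (tw_colim L i));
     tw_map_nat := fun i j s => eq_sym (tw_colim_flat_fac L s d) |}.

Definition tw_colim_desc (I : Category) (B : AdjunctionBundle I) (D : Category)
  (G : Functor D (Tw B)) (L : forall i, Colimit (functor_comp (Ev B i) G))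
  (X : Tw B) (c : Cocone G X) : TwHom (tw_colim L) X.
Proof.
  refine {| tw_map := fun i => (colim_desc (L i) (map_cocone (Ev B i) c)
                                 : Hom (tw_colim L i) ((X : TwDiag B) i)) |}.
  intros i j s; apply colim_hom_ext; intros d.
  pose proof (colim_fac (L i) (map_cocone (Ev B i) c) d) as faci.
  pose proof (colim_fac (L j) (map_cocone (Ev B j) c) d) as facj.
  simpl in faci, facj |- *.
  rewrite <- !comp_assoc, tw_colim_flat_fac, comp_assoc, <- fmap_comp, faci, facj.
  exact (tw_map_nat (c d) s).
Defined.

Definition tw_colimit (I : Category) (B : AdjunctionBundle I) (D : Category)
  (G : Functor D (Tw B)) (L : forall i, Colimit (functor_comp (Ev B i) G)) :
  Colimit G.
Proof.
  unshelve refine {| colim := tw_colim L : Tw B;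
            colim_cocone :=
              {| cocone_leg := tw_colim_leg L : forall d, @Hom (Tw B) _ _ |};
            colim_desc := tw_colim_desc L |}.
  - intros d d' u; apply TwHom_ext; intros i.
    exact (cocone_nat (colim_cocone (L i)) u).
  - intros X c d; apply TwHom_ext; intros i.
    exact (colim_fac (L i) (map_cocone (Ev B i) c) d).
  - intros X c h e; apply TwHom_ext; intros i.
    apply colim_uniq; intros d.
    exact (f_equal (fun f : TwHom (G d) X => f i) (e d)).
Defined.

Lemma tw_colimit_compare_iso (I : Category) (B : AdjunctionBundle I)
  (D : Category) (G : Functor D (Tw B))
  (L : forall i, Colimit (functor_comp (Ev B i) G)) (i : I) :
  is_iso (colim_compare (tw_colimit L) (L i)).
Proof.
  assert (e : colim_compare (tw_colimit L) (L i) = idm (L i : B i)).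
  { symmetry; apply colim_uniq; intros d; apply comp_idl. }
  rewrite e; exists (idm (L i : B i)); split; apply comp_idl.
Qed.

(** * Existence and fibrewise computation *)

Lemma inhabited_pi (A : Type) (P : A -> Type) :
  (forall a, inhabited (P a)) -> inhabited (forall a, P a).
Proof.
  intros h; constructor; intros a.
  assert (e : exists _ : P a, True)
    by (destruct (h a) as [x]; exists x; exact Logic.I).
  exact (proj1_sig (constructive_indefinite_description _ e)).
Qed.

Theorem proposition2p3p1 :
  forall (I : Category) (B : AdjunctionBundle I) (D : Category)
         (G : Functor D (Tw B)),
    ((forall i : I, inhabited (Limit (functor_comp (Ev B i) G))) ->
       inhabited (Limit G) /\
       forall (L : Limit G) (i : I) (Li : Limit (functor_comp (Ev B i) G)),
         is_iso (lim_compare L Li))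
    /\
    ((forall i : I, inhabited (Colimit (functor_comp (Ev B i) G))) ->
       inhabited (Colimit G) /\
       forall (L : Colimit G) (i : I) (Li : Colimit (functor_comp (Ev B i) G)),
         is_iso (colim_compare L Li)).
Proof.
  intros I B D G; split; intros ex; destruct (inhabited_pi ex) as [L0]; split.
  - constructor; exact (tw_limit L0).
  - intros L i Li.
    exact (lim_compare_iso_indep L Li (tw_limit_compare_iso L0 i)).
  - constructor; exact (tw_colimit L0).
  - intros L i Li.
    exact (colim_compare_iso_indep L Li (tw_colimit_compare_iso L0 i)).
Qed.
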